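(* Let $S\subset\mathbb{R}^n$ be a surface of class $C^3$ with band $B(S)$ (as in the context). Let $A:S\to\mathbb{R}^{n\times n}$ be a $C^1$ tensor field that maps tangent vectors to tangent vectors, i.e. $A(y)\xi\in\mathcal{T}_yS$ for all $y\in S$ and all $\xi\in\mathcal{T}_yS$. Let $\operatorname{cp}:B(S)\to S$ be a $C^2$-smooth closest point function such that the transpose of its Jacobian maps tangent vectors to tangent vectors, i.e. $$\text{for all } x\in B(S)\text{ and all }\xi\in\mathcal{T}_{\operatorname{cp}(x)}S:\qquad D\operatorname{cp}(x)^T\xi\in\mathcal{T}_{\operatorname{cp}(x)}S .$$ Then for every $u\in C^2(S)$, $$\operatorname{div}_S\left(A\nabla_Su\right)(y)=\operatorname{div}\left((A\circ\operatorname{cp})\,\nabla[u\circ\operatorname{cp}]\right)(y)\qquad\text{for all } y\in S,$$ where $\operatorname{div}$ and $\nabla$ are the ordinary divergence and gradient in $\mathbb{R}^n$, applied to functions on $B(S)$.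
   Context: Surfaces. $S$ is an embedded submanifold of $\mathbb{R}^n$ (here of class $C^3$) without boundary (if there is a boundary, $S$ is identified with its interior), of dimension $k\le n$, possessing a tubular neighborhood $B(S)\subset\mathbb{R}^n$, an open set containing $S$, called a band around $S$. $S$ is orientable in the sense that, if $k<n$, there are smooth unit vector fields $N_1,\dots,N_{n-k}:S\to\mathbb{R}^n$ spanning the normal space $\mathcal{N}_yS$ at each $y\in S$. $\mathcal{T}_yS$ is the tangent space, and $P(y)\in\mathbb{R}^{n\times n}$ is the orthogonal projector of $\mathbb{R}^n$ onto $\mathcal{T}_yS$. Surface differential operators. For a $C^1$ surface function and a point $y\in S$, let the subscript $E$ denote any $C^1$ extension to an open set of $\mathbb{R}^n$ containing $y$ (agreeing with the given function on the part of $S$ in this open set). For $u:S\to\mathbb{R}$, $\nabla_Su(y)^T:=\nabla u_E(y)^T\cdot P(y)$; for $g:S\to\mathbb{R}^n$ (not necessarily tangential), $\operatorname{div}_Sg(y):=\operatorname{trace}(Dg_E(y)\cdot P(y))$. These are independent of the chosen extension. Closest point function. A map $\operatorname{cp}:B(S)\to S$ is a closest point function if (1) it is a $C^1$-retraction, i.e. $\operatorname{cp}$ is continuously differentiable (as a map into $\mathbb{R}^n$) and $\operatorname{cp}(y)=y$ for all $y\in S$; and (2) its Jacobian satisfies $D\operatorname{cp}(y)=P(y)$ for all $y\in S$. *)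

(* Defs.v *)
From HB Require Import structures.
From mathcomp Require Import all_boot all_order all_algebra.
From mathcomp Require Import all_classical all_reals all_analysis.

Set Implicit Arguments.
Unset Strict Implicit.
Unset Printing Implicit Defensive.

Import Order.TTheory GRing.Theory Num.Theory.
Import numFieldNormedType.Exports.

Local Open Scope classical_set_scope.
Local Open Scope ring_scope.

(* Points and vectors of R^n are column vectors 'cV[R]_n.  Functions on a     *)
(* subset (a surface, a band) are total functions of which only the values on *)
(* that subset are ever constrained or used.                                  *)

Section Smoothness.
Context {R : realType}.

(* Class C^r on an open set U; all directional derivatives of order at most r *)
(* exist and are continuous on U.                                             *)
Fixpoint Cr {V W : normedModType R} (r : nat) (U : set V) (f : V -> W) : Prop :=
  match r with
  | 0 => forall x, U x -> {for x, continuous f}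
  | s.+1 => (forall x, U x -> differentiable f x)
            /\ forall v : V, Cr s U (fun x => 'D_v f x)
  end.

(* g is a C^r extension of f : X -> W to an open set containing y. *)
Definition Cr_extension {V W : normedModType R} (r : nat) (X : set V)
    (f : V -> W) (y : V) (g : V -> W) : Prop :=
  exists U : set V, [/\ open U, U y, Cr r U g & forall x, X x -> U x -> g x = f x].

(* Class C^r on an arbitrary subset X of V, in particular on a submanifold. *)
Definition Cr_on {V W : normedModType R} (r : nat) (X : set V) (f : V -> W) :=
  forall y, X y -> exists g, Cr_extension r X f y g.

Definition diffeo {V W : normedModType R} (r : nat) (X : set V) (Y : set W)
    (f : V -> W) (g : W -> V) : Prop :=
  [/\ Cr_on r X f, Cr_on r Y g,
      forall x, X x -> Y (f x) /\ g (f x) = x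
    & forall z, Y z -> X (g z) /\ f (g z) = z].

End Smoothness.

Section Euclidean.
Context {R : realType} {n : nat}.
Implicit Types (x v w : 'cV[R]_n).

Definition dot v w : R := (v^T *m w) 0 0.

Definition grad (f : 'cV[R]_n -> R) x : 'cV[R]_n :=
  \col_i 'D_(delta_mx i 0) f x.

Definition Jac (g : 'cV[R]_n -> 'cV[R]_n) x : 'M[R]_n :=
  \matrix_(i, j) ('D_(delta_mx j 0) g x) i 0.

Definition div (g : 'cV[R]_n -> 'cV[R]_n) x : R := \tr (Jac g x).

End Euclidean.

Section Surface.
Context {R : realType} {n : nat}.
Local Notation E := 'cV[R]_n.
Implicit Types (S B : set E) (x y v xi : E).

(* Embedded k-dimensional C^r submanifold of R^n, without boundary: near each *)
(* point, phi straightens S to the coordinate plane R^k x {0}.                *)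
Definition submanifold (r k : nat) S : Prop :=
  forall y, S y -> exists (U V : set E) (phi psi : E -> E),
    [/\ open U, U y, open V, diffeo r U V phi psi
      & forall x, U x -> (S x <-> forall i : 'I_n, (k <= i)%N -> phi x i 0 = 0)].

(* Velocities at y of the C^1 curves in S through y. *)
Definition tangent S y : set E := [set xi |
  exists (c : R -> E) (e : R),
    [/\ 0 < e, Cr 1 [set` `]-e, e[] c, forall t, t \in `]-e, e[ -> S (c t),
        c 0 = y & derive1 c 0 = xi]].

Definition normal S y : set E := [set v | forall xi, tangent S y xi -> dot v xi = 0].

(* The unit normal fields of a C^3 surface are of class C^2. *)
Definition orientable (k : nat) S : Prop :=
  (k < n)%N -> exists N : 'I_(n - k) -> E -> E,
    (forall i, Cr_on 2 S (N i)) /\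
    forall y, S y ->
      (forall i, dot (N i y) (N i y) = 1) /\
      (forall v, normal S y v <->
        exists a : 'I_(n - k) -> R, v = \sum_i a i *: N i y).

Definition normal_bundle S : set (E * E) := [set p | S p.1 /\ normal S p.1 p.2].

(* B is the image of an open neighbourhood W of the zero section of the normal *)
(* bundle (a C^2 manifold if S is C^3) under a C^2 diffeomorphism Phi that     *)
(* restricts to the identity on S; (y, v) |-> y + v is the usual Phi.          *)
Definition tubular_neighborhood S B : Prop :=
  [/\ open B, S `<=` B
    & exists (W : set (E * E)) (Phi : E * E -> E) (Psi : E -> E * E),
      [/\ open W, forall y, S y -> W (y, 0),
          diffeo 2 (normal_bundle S `&` W) B Phi Psi
        & forall y, S y -> Phi (y, 0) = y]].

Definition orthogonal_projector (T : set E) (P : 'M[R]_n) : Prop :=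
  forall v, T (P *m v) /\ forall xi, T xi -> dot (v - P *m v) xi = 0.

(* P(y), which orthogonal_projector determines uniquely. *)
Definition proj S y : 'M[R]_n :=
  xget 0 [set P | orthogonal_projector (tangent S y) P].

(* A choice of C^1 extension f_E of f near y; the operators below do not *)
(* depend on it.                                                         *)
Definition ext {W : normedModType R} S (f : E -> W) y : E -> W :=
  xget f [set g | Cr_extension 1 S f y g].

(* Column form of (grad_S u)^T = (grad u_E)^T P. *)
Definition sgrad S (u : E -> R) y : E := ((grad (ext S u y) y)^T *m proj S y)^T.

Definition sdiv S (g : E -> E) y : R := \tr (Jac (ext S g y) y *m proj S y).

Definition closest_point S B (cp : E -> E) : Prop :=
  [/\ forall x, B x -> S (cp x), Cr 1 B cp, forall y, S y -> cp y = y
    & forall y, S y -> Jac cp y = proj S y].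

End Surface.

(* Main.v *)
Require Import Defs.
From HB Require Import structures.
From mathcomp Require Import all_boot all_order all_algebra.
From mathcomp Require Import all_classical all_reals all_analysis.
Import Order.TTheory GRing.Theory Num.Theory.
Import numFieldNormedType.Exports.
Local Open Scope classical_set_scope.
Local Open Scope ring_scope.

(** The closest point function does all the geometric work. Since [cp] fixes [S]
    pointwise and maps the band into [S], the tangent space at [y] is the range of
    [P = Jac cp y], and composing any extension of a surface function with [cp]
    gives [D(f \o cp)(y) = Df_E(y) P]. Hence [sgrad S u = grad (u \o cp)] on [S] and
    [sdiv S g = div (g \o cp)]. The field [G x = A (cp x) *m grad (u \o cp) x] is a
    C^1 extension of [A *m sgrad S u], and by the hypothesis on the transposed
    Jacobian of [cp] it is tangent to [S] at [cp x], that is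
    [Jac cp (cp x) *m G x = G x]. For such fields [div (G \o cp) = div G] on [S]. *)

(** * Chain and product rules for directional derivatives, in matrix form *)

Section DirectionalDerivatives.
Context {R : realType}.
Implicit Types V W : normedModType R.

Lemma derive_comp {V V' W} (g : V' -> W) (f : V -> V') (x v : V) :
  differentiable f x -> differentiable g (f x) ->
  'D_v (g \o f) x = 'D_('D_v f x) g (f x).
Proof.
move=> df dg; rewrite !deriveE//; last exact: differentiable_comp.
by rewrite diff_comp.
Qed.

Lemma derive_cV {n} {W} (g : 'cV[R]_n -> W) (x v : 'cV[R]_n) :
  differentiable g x -> 'D_v g x = \sum_i v i 0 *: 'D_(delta_mx i 0) g x.
Proof.
move=> dg; rewrite deriveE// [in LHS](matrix_sum_delta v) linear_sum.
apply: eq_bigr => i _; rewrite big_ord1 linearZ/= deriveE//.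
Qed.

Lemma derive_Jac {n} (g : 'cV[R]_n -> 'cV[R]_n) (x v : 'cV[R]_n) :
  differentiable g x -> 'D_v g x = Jac g x *m v.
Proof.
move=> dg; rewrite derive_cV//; apply/matrixP => i j.
rewrite summxE !mxE; apply: eq_bigr => l _.
by rewrite !mxE !ord1 mulrC.
Qed.

Lemma derive_grad {n} (g : 'cV[R]_n -> R) (x v : 'cV[R]_n) :
  differentiable g x -> 'D_v g x = dot (grad g x) v.
Proof.
move=> dg; rewrite derive_cV// /dot !mxE.
by apply: eq_bigr => i _; rewrite !mxE mulrC.
Qed.

Lemma Jac_col {n} (g : 'cV[R]_n -> 'cV[R]_n) (x : 'cV[R]_n) i :
  Jac g x *m delta_mx i 0 = 'D_(delta_mx i 0) g x.
Proof. by apply/matrixP => j l; rewrite -colE !mxE ord1. Qed.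

Lemma Jac_chain {n} (g f : 'cV[R]_n -> 'cV[R]_n) x :
  differentiable f x -> differentiable g (f x) ->
  Jac (g \o f) x = Jac g (f x) *m Jac f x.
Proof.
move=> df dg; apply/matrixP => i j; rewrite mxE derive_comp// derive_Jac//.
by rewrite -Jac_col mulmxA -colE !mxE.
Qed.

Lemma grad_chain {n} (g : 'cV[R]_n -> R) (f : 'cV[R]_n -> 'cV[R]_n) x :
  differentiable f x -> differentiable g (f x) ->
  grad (g \o f) x = (Jac f x)^T *m grad g (f x).
Proof.
move=> df dg; apply/matrixP => i j; rewrite !mxE derive_comp// derive_cV//.
by apply: eq_bigr => l _; rewrite !mxE.
Qed.

Lemma derivable_mulmx {V} {m p q} (M : V -> 'M[R]_(m, p)) (N : V -> 'M[R]_(p, q))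
    (x v : V) : derivable M x v -> derivable N x v ->
  derivable (fun z => M z *m N z) x v.
Proof.
move=> /derivable_mxP dM /derivable_mxP dN; apply/derivable_mxP => i j.
rewrite (_ : (fun _ => _) =
  \sum_(l < p) ((fun z => M z i l) * (fun z => N z l j))); last first.
  by apply/funext => z; rewrite mxE fct_sumE.
by apply: derivable_sum => l; exact: derivableM.
Qed.

Lemma derive_mulmx {V} {m p q} (M : V -> 'M[R]_(m, p)) (N : V -> 'M[R]_(p, q))
    (x v : V) : derivable M x v -> derivable N x v ->
  'D_v (fun z => M z *m N z) x = 'D_v M x *m N x + M x *m 'D_v N x.
Proof.
move=> dM dN; rewrite (derive_mx (derivable_mulmx _ _ _ _ dM dN)).
rewrite (derive_mx dM) (derive_mx dN).
move/derivable_mxP in dM; move/derivable_mxP in dN.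
apply/matrixP => i j; rewrite !mxE -big_split/=.
rewrite (_ : (fun _ => _) =
  \sum_(l < p) ((fun z => M z i l) * (fun z => N z l j))); last first.
  by apply/funext => z; rewrite mxE fct_sumE.
rewrite derive_sum; last by move=> l; exact: derivableM.
apply: eq_bigr => l _; rewrite deriveM// !mxE addrC.
by rewrite ['D_v (fun t => M t i l) x * _]mulrC.
Qed.

End DirectionalDerivatives.

(** * Closure properties of class C^1 on open sets *)

Section ClassC1.
Context {R : realType}.
Implicit Types V W : normedModType R.

Lemma Cr0_eq {V W} (U : set V) (f g : V -> W) : open U ->
  (forall x, U x -> f x = g x) -> Cr 0 U f -> Cr 0 U g.
Proof.
move=> oU fg cf x Ux; have /= := cf x Ux.
rewrite /prop_for /continuous_at (fg x Ux); apply: cvg_trans.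
apply: near_eq_cvg; near=> z; rewrite fg//.
by near: z; exact: open_nbhs_nbhs.
Unshelve. all: by end_near. Qed.

(** Differentiation rules give a formula [df] that agrees with the derivative on [U] only; since [U]
    is open, continuity at points of [U] still passes from the formula to the derivative. *)
Lemma Cr1_intro {V W} (U : set V) (f : V -> W) (df : V -> V -> W) : open U ->
  (forall x, U x -> differentiable f x) ->
  (forall v x, U x -> df v x = 'D_v f x) ->
  (forall v, Cr 0 U (df v)) -> Cr 1 U f.
Proof. by move=> oU dif dfE cdf; split=> // v; apply: Cr0_eq (cdf v) => // x /dfE. Qed.

Lemma Cr1_diff {V W} (U : set V) (f : V -> W) x :
  Cr 1 U f -> U x -> differentiable f x.
Proof. by case=> + _; exact. Qed.

Lemma Cr_derive {V W} r (U : set V) (f : V -> W) v :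
  Cr r.+1 U f -> Cr r U (fun x => 'D_v f x).
Proof. by case=> _; exact. Qed.

Lemma Cr1_Cr0 {V W} (U : set V) (f : V -> W) : Cr 1 U f -> Cr 0 U f.
Proof. by case=> df _ x /df /differentiable_continuous. Qed.

Lemma Cr2_Cr1 {V W} (U : set V) (f : V -> W) : Cr 2 U f -> Cr 1 U f.
Proof. by case=> df Df; split=> // v; exact/Cr1_Cr0/Df. Qed.

Lemma Cr_sub {V W} r (U U' : set V) (f : V -> W) :
  U' `<=` U -> Cr r U f -> Cr r U' f.
Proof.
move=> UU; elim: r f => [|r IH] f /=; first by move=> cf x /UU; exact: cf.
by case=> df Df; split=> [x /UU|v]; [exact: df|exact/IH/Df].
Qed.

Lemma Cr1_cst {V W} (U : set V) (w : W) : Cr 1 U (fun=> w).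
Proof.
split=> [x _|v x _]; first exact: differentiable_cst.
under [X in {for _, continuous X}]funext do rewrite derive_cst.
exact: cst_continuous.
Qed.

Lemma Cr1D {V W} (U : set V) (f g : V -> W) : open U ->
  Cr 1 U f -> Cr 1 U g -> Cr 1 U (fun x => f x + g x).
Proof.
move=> oU [df cf] [dg cg].
apply: (@Cr1_intro _ _ _ _ (fun v x => 'D_v f x + 'D_v g x)) => //.
- by move=> x Ux; apply: differentiableD; [exact: df|exact: dg].
- by move=> v x Ux; rewrite deriveD//; apply: diff_derivable; [exact: df|exact: dg].
- by move=> v x Ux; apply: continuousD; [exact: cf|exact: cg].
Qed.

Lemma Cr1M {V} (U : set V) (f g : V -> R) : open U ->
  Cr 1 U f -> Cr 1 U g -> Cr 1 U (fun x => f x * g x).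
Proof.
move=> oU Cf Cg; have [df cf] := Cf; have [dg cg] := Cg.
have cf0 := Cr1_Cr0 _ _ Cf; have cg0 := Cr1_Cr0 _ _ Cg.
apply: (@Cr1_intro _ _ _ _ (fun v x => f x * 'D_v g x + g x * 'D_v f x)) => //.
- by move=> x Ux; apply: differentiableM; [exact: df|exact: dg].
- by move=> v x Ux; rewrite deriveM//; apply: diff_derivable; [exact: df|exact: dg].
- move=> v x Ux.
  exact: cvgD (cvgM (cf0 x Ux) (cg v x Ux)) (cvgM (cg0 x Ux) (cf v x Ux)).
Qed.

Lemma Cr1Zl {V W} (U : set V) (f : V -> R) (w : W) : open U ->
  Cr 1 U f -> Cr 1 U (fun x => f x *: w).
Proof.
move=> oU [df cf].
apply: (@Cr1_intro _ _ _ _ (fun v x => 'D_v f x *: w)) => //.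
- by move=> x Ux; apply: differentiableZl; exact: df.
- move=> v x Ux; rewrite !deriveE; last exact: df.
    by rewrite diffZl//; exact: df.
  by apply: differentiableZl; exact: df.
- by move=> v x Ux; apply: cvgZr_tmp; exact: cf.
Qed.

Lemma Cr1_sum {V W} {I : Type} (r : seq I) (U : set V) (f : I -> V -> W) :
  open U -> (forall i, Cr 1 U (f i)) -> Cr 1 U (fun x => \sum_(i <- r) f i x).
Proof.
move=> oU Cf; elim: r => [|i r IH].
  by under [X in Cr _ _ X]funext do rewrite big_nil; exact: Cr1_cst.
under [X in Cr _ _ X]funext do rewrite big_cons.
exact: Cr1D.
Qed.

Lemma derive_coord {V} {m p} (M : V -> 'M[R]_(m, p)) (x v : V) i j :
  derivable M x v -> ('D_v M x) i j = 'D_v (fun z => M z i j) x.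
Proof. by move=> dM; rewrite derive_mx// mxE. Qed.

(** For the converse direction, a matrix field is the finite sum of its entries times the constant
    elementary matrices. *)
Lemma Cr1_mxP {V} {m p} (U : set V) (M : V -> 'M[R]_(m, p)) : open U ->
  Cr 1 U M <-> forall i j, Cr 1 U (fun x => M x i j).
Proof.
move=> oU; split=> [[dM cM] i j|CM].
- apply: (@Cr1_intro _ _ _ _ (fun v x => ('D_v M x) i j)) => //.
  + move=> x Ux; apply: (@differentiable_comp _ _ _ _ M (fun N => N i j)).
      exact: dM.
    exact: differentiable_coord.
  + by move=> v x Ux; rewrite derive_coord//; apply: diff_derivable; exact: dM.
  + move=> v x Ux; apply: (@continuous_comp _ _ _ ('D_v M) (fun N => N i j)).
      exact: cM.
    exact: coord_continuous.
- under [X in Cr _ _ X]funext do rewrite (matrix_sum_delta (M _)).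
  by apply: Cr1_sum => // i; apply: Cr1_sum => // j; apply: Cr1Zl.
Qed.

Lemma Cr1_mulmx {V} {m p q} (U : set V) (M : V -> 'M[R]_(m, p))
    (N : V -> 'M[R]_(p, q)) : open U ->
  Cr 1 U M -> Cr 1 U N -> Cr 1 U (fun x => M x *m N x).
Proof.
move=> oU /(Cr1_mxP _ _ oU) CM /(Cr1_mxP _ _ oU) CN; apply/Cr1_mxP => // i j.
under [X in Cr _ _ X]funext do rewrite mxE.
by apply: Cr1_sum => // l; exact: Cr1M.
Qed.

(** The direction ['D_v f x] in the chain rule moves with [x], whereas [Cr] gives continuity for
    fixed directions only. Expanding it in the standard basis, hence the column-vector domain of
    [g], leaves only the fixed directions [delta_mx i 0]. *)
Lemma Cr1_comp {V W} {n} (U : set V) (U' : set 'cV[R]_n) (f : V -> 'cV[R]_n)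
    (g : 'cV[R]_n -> W) : open U -> (forall x, U x -> U' (f x)) ->
  Cr 1 U f -> Cr 1 U' g -> Cr 1 U (g \o f).
Proof.
move=> oU UU' Cf Cg; have [df cf] := Cf; have [dg cg] := Cg.
have cf0 := Cr1_Cr0 _ _ Cf.
apply: (@Cr1_intro _ _ _ _ (fun v x =>
  \sum_i ('D_v f x) i 0 *: 'D_(delta_mx i 0) g (f x))) => //.
- by move=> x Ux; apply: differentiable_comp; [exact: df|exact/dg/UU'].
- move=> v x Ux; have dgx := dg _ (UU' _ Ux).
  by rewrite (derive_comp _ _ _ _ (df x Ux) dgx) derive_cV.
- move=> v x Ux.
  apply: cvg_big => [|i _]; first exact: add_continuous.
  apply: cvgZ.
    apply: (@continuous_comp _ _ _ ('D_v f) (fun N => N i 0)); first exact: cf.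
    exact: coord_continuous.
  apply: (@continuous_comp _ _ _ f ('D_(delta_mx i 0) g)); first exact: cf0.
  exact/cg/UU'.
Qed.

End ClassC1.

(** * Geometry of the closest point function and the surface operators *)

Section ClosestPoint.
Context {R : realType} {n : nat}.
Local Notation E := 'cV[R]_n.
Variables (S B : set E) (cp : E -> E).
Hypotheses (oB : open B) (SB : S `<=` B) (cpS : closest_point S B cp).

Let cp_in x : B x -> S (cp x). Proof. by case: cpS => + _ _ _; exact. Qed.
Let cp_id y : S y -> cp y = y. Proof. by case: cpS => _ _ + _; exact. Qed.
Let cp_C1 : Cr 1 B cp. Proof. by case: cpS. Qed.
Let cp_proj y : S y -> Jac cp y =
  Defs.proj S y. Proof. by case: cpS => _ _ _; exact. Qed.
Let cp_diff x : B x -> differentiable cp x. Proof. by case: cp_C1 => + _; exact. Qed.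

Lemma near_band y : S y -> \forall x \near y, B x.
Proof. by move=> Sy; apply: open_nbhs_nbhs; split => //; exact: SB. Qed.

Lemma near_cp (U : set E) y : S y -> nbhs y U -> \forall x \near y, U (cp x).
Proof.
move=> Sy nU; have := differentiable_continuous (cp_diff y (SB y Sy)); apply.
by rewrite /= cp_id.
Qed.

(** Continuity of [cp] is known on the band only, hence the intersection with [B]. *)
Lemma open_cp_preimage (U : set E) : open U -> open (B `&` cp @^-1` U).
Proof.
move=> oU; rewrite openE => x [Bx Ux]; near=> z; split.
  by near: z; exact: open_nbhs_nbhs.
near: z; have := differentiable_continuous (cp_diff x Bx); apply.
exact: open_nbhs_nbhs.
Unshelve. all: by end_near. Qed.

(** Differentiate [cp \o c = c] at 0 along a curve [c] in [S] with velocity [xi]. *)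
Lemma Jac_cp_tangent y xi : S y -> tangent S y xi -> Jac cp y *m xi = xi.
Proof.
move=> Sy [c [e [e0 Cc cS c0 cxi]]].
have in0 : 0 \in `]-e, e[ by rewrite in_itv/= oppr_lt0 e0.
have dc : differentiable c 0 by case: Cc => + _; apply.
rewrite -derive_Jac; last exact/cp_diff/SB.
have <- : 'D_1 c 0 = xi by rewrite -derive1E.
rewrite -[in X in 'D_(_) _ X]c0 -derive_comp//; last by rewrite c0; exact/cp_diff/SB.
apply: near_eq_derive; near=> t => /=; rewrite cp_id//; apply: cS.
near: t; exact: near_in_itvoo.
Unshelve. all: by end_near. Qed.

(** The witness is the curve [cp (y + t *: v)]: the line stays in the open band for small [t], and
    [cp] pushes it into [S]. *)
Lemma tangent_Jac_cp y v : S y -> tangent S y (Jac cp y *m v).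
Proof.
move=> Sy; pose l (t : R) : E := y + t *: v.
have l0 : l 0 = y by rewrite /l scale0r addr0.
have Cid (U : set R) : Cr 1 U (fun t : R => t).
  split=> [t _|w t _]; first by have [] := is_diff_id t.
  under [X in {for _, continuous X}]funext do rewrite derive_id.
  exact: cst_continuous.
have Cl (U : set R) : open U -> Cr 1 U l.
  move=> oU; apply: Cr1D => //; first exact: Cr1_cst.
  exact: Cr1Zl.
have dl t : differentiable l t.
  by apply: (Cr1_diff _ _ _ (Cl setT openT)).
have Dl : 'D_1 l 0 = v.
  rewrite /l deriveD; last 2 first.
  - exact: derivable_cst.
  - apply: diff_derivable; exact: (Cr1_diff _ _ _ (Cr1Zl setT _ v openT (Cid _))).
  rewrite derive_cst add0r deriveE; last first.
    exact: (Cr1_diff _ _ _ (Cr1Zl setT _ v openT (Cid _))).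
  by rewrite (@diffZl _ _ _ id)// diff_val scale1r.
have : \forall t \near (0 : R), B (l t).
  have := differentiable_continuous (dl 0); apply.
  by rewrite /= l0; exact: near_band.
move=> /nbhs_ballP[e /= e0 eB].
have lB t : t \in `]-e, e[ -> B (l t).
  by rewrite in_itv/= => te; apply: eB; rewrite /ball/= sub0r normrN ltr_norml.
exists (cp \o l), e; split => //.
- have oI : open [set` `]-e, e[] by exact: itv_open.
  exact: Cr1_comp _ _ _ _ oI lB (Cl _ oI) cp_C1.
- by move=> t /lB; exact: cp_in.
- by rewrite /= l0 cp_id.
- have By := SB _ Sy.
  rewrite derive1E derive_comp ?l0//; last exact: cp_diff.
  by rewrite Dl derive_Jac//; exact: cp_diff.
Qed.

Lemma Jac_cp_idem y : S y -> Jac cp y *m Jac cp y = Jac cp y.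
Proof.
move=> Sy; apply/matrixP => i j.
have /matrixP/(_ i 0) :=
  Jac_cp_tangent _ _ Sy (tangent_Jac_cp _ (delta_mx j 0) Sy).
by rewrite mulmxA -!colE ![col _ _ _ _]mxE.
Qed.

(* Where no orthogonal projector exists, [proj] is the junk value 0. *)
Lemma trmx_Jac_cp y : S y -> (Jac cp y)^T = Jac cp y.
Proof.
move=> Sy; have [PP|noP] := pselect (exists P, orthogonal_projector (tangent S y) P).
  have := xgetPex 0 PP; rewrite -/(Defs.proj S y) -cp_proj//; set P := Jac cp y => hP.
  (* Test the orthogonality of [e_i - P e_i] to the tangent space on the tangent vector [P e_j]; the
     resulting identity makes [P] symmetric. *)
  have PTP : P^T *m P = P.
    apply/matrixP => i j.
    have [_ /(_ _ (tangent_Jac_cp _ (delta_mx j 0) Sy))] := hP (delta_mx i 0).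
    rewrite -/P /dot linearB/= trmx_mul trmx_delta mulmxBl -mulmxA !mulmxA.
    rewrite -!mulmxA -!rowE (mulmxA P^T) -!colE => /eqP.
    by rewrite !mxE subr_eq0 => /eqP ->.
  by rewrite -{1}PTP trmx_mul trmxK.
rewrite cp_proj// /Defs.proj xgetPN ?trmx0// => P hP; by apply: noP; exists P.
Qed.

(** Since [cp] takes values in [S], the functions [f \o cp] and [g \o cp] coincide near [y], and the
    chain rule applies to the latter. The left side does not mention [g], so any choice of extension
    gives the same tangential derivatives. *)
Lemma derive_ext_cp {W : normedModType R} (f g : E -> W) y v :
  S y -> Cr_extension 1 S f y g -> 'D_v (f \o cp) y = 'D_(Jac cp y *m v) g y.
Proof.
move=> Sy [U [oU Uy [dg _] gf]].
rewrite -derive_Jac; last exact/cp_diff/SB.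
rewrite -[in X in _ = 'D_(_) _ X](cp_id _ Sy) -derive_comp; last 2 first.
- exact/cp_diff/SB.
- by rewrite cp_id//; exact: dg.
apply: near_eq_derive; near=> x => /=; rewrite gf//.
- by apply: cp_in; near: x; exact: near_band.
- by near: x; apply: near_cp => //; exact: open_nbhs_nbhs.
Unshelve. all: by end_near. Qed.

Lemma extP {W : normedModType R} (f : E -> W) y :
  (exists g, Cr_extension 1 S f y g) -> Cr_extension 1 S f y (ext S f y).
Proof. exact: xgetPex. Qed.

Lemma Cr_extension_diff {W : normedModType R} (f g : E -> W) y :
  Cr_extension 1 S f y g -> differentiable g y.
Proof. by move=> [U [_ Uy [dg _] _]]; exact: dg. Qed.

(** An extension must exist so that [ext] returns one rather than its default value. *)
Lemma sgrad_cp (u : E -> R) y : S y -> (exists g, Cr_extension 1 S u y g) ->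
  sgrad S u y = grad (u \o cp) y.
Proof.
move=> Sy /extP eu; rewrite /sgrad -cp_proj//; apply/matrixP => i j.
rewrite ord1 [RHS]mxE (derive_ext_cp _ _ _ _ Sy eu).
rewrite derive_grad; last exact: Cr_extension_diff eu.
by rewrite /dot mulmxA -colE !mxE.
Qed.

Lemma sdiv_cp (g : E -> E) y : S y -> (exists h, Cr_extension 1 S g y h) ->
  sdiv S g y = div (g \o cp) y.
Proof.
move=> Sy /extP eg; rewrite /sdiv /div -cp_proj//; congr (\tr _).
apply/matrixP => i j; rewrite [RHS]mxE (derive_ext_cp _ _ _ _ Sy eg).
rewrite derive_Jac; last exact: Cr_extension_diff eg.
by rewrite mulmxA -colE !mxE.
Qed.

(** Differentiate [cp \o cp = cp], which holds on the whole band and not only on [S]. *)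
Lemma Jac_cp_absorb x : B x -> Jac cp (cp x) *m Jac cp x = Jac cp x.
Proof.
move=> Bx; have Bcx := SB _ (cp_in _ Bx).
rewrite -Jac_chain; [|exact: cp_diff|exact: cp_diff].
apply/matrixP => i j; rewrite !mxE.
congr (fun_of_matrix _ i 0); apply: near_eq_derive; near=> z => /=.
by apply: cp_id; apply: cp_in; near: z; exact: open_nbhs_nbhs.
Unshelve. all: by end_near. Qed.

Hypothesis cp_C2 : Cr 2 B cp.

(* Both [G] and [G \o cp] are fixed by [Jac cp (cp x)]. Differentiating, the terms
   in which the projector is differentiated agree at [y]; with [K = Jac G y] this
   leaves [K - K P = P (K - K P)], whose trace vanishes because [P P = P]. *)
Lemma div_cp_tangential (G : E -> E) y : S y -> differentiable G y ->
  (\forall x \near y, Jac cp (cp x) *m G x = G x) ->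
  div (G \o cp) y = div G y.
Proof.
move=> Sy dG nG; have By := SB _ Sy; set P := Jac cp y.
have dcp : differentiable cp y by exact: cp_diff.
have dGcp : differentiable G (cp y) by rewrite cp_id.
(* The projector [Jac cp (cp x)] is itself differentiated, which is where second derivatives of [cp]
   enter. *)
have dJ v : derivable (fun x => Jac cp (cp x)) y v.
  apply/derivable_mxP => i j.
  have -> : (fun x => Jac cp (cp x) i j) =
      (fun x => 'D_(delta_mx j 0) cp x i 0) \o cp.
    by apply/funext => x; rewrite /= mxE.
  apply: diff_derivable; apply: differentiable_comp => //; rewrite cp_id//.
  have /(Cr1_mxP _ _ oB)/(_ i 0) CD := Cr_derive _ _ _ (delta_mx j 0) cp_C2.
  exact: Cr1_diff CD By.
have dGv v : derivable G y v by exact: diff_derivable.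
have dGcpv v : derivable (G \o cp) y v.
  by apply: diff_derivable; exact: differentiable_comp.
have DG v : 'D_v G y = 'D_v (fun x => Jac cp (cp x)) y *m G y + P *m 'D_v G y.
  transitivity ('D_v (fun x => Jac cp (cp x) *m G x) y).
    exact/esym/near_eq_derive.
  by have := derive_mulmx _ _ _ _ (dJ v) (dGv v); rewrite cp_id.
(* Because [cp (cp x) = cp x], the same factor [Jac cp (cp x)] fixes [G (cp x)]; with [cp y = y],
   the term containing its derivative is exactly the one in [DG]. *)
have DGcp v : 'D_v (G \o cp) y =
    'D_v (fun x => Jac cp (cp x)) y *m G y + P *m 'D_v (G \o cp) y.
  transitivity ('D_v (fun x => Jac cp (cp x) *m (G \o cp) x) y); last first.
    by have := derive_mulmx _ _ _ _ (dJ v) (dGcpv v); rewrite /= cp_id.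
  apply/esym/near_eq_derive.
  apply: filterS2 (near_band _ Sy) (near_cp _ _ Sy nG) => x Bx.
  by rewrite (cp_id (cp x))//; exact: cp_in.
set K := Jac G y; have KP : Jac (G \o cp) y = K *m P.
  by rewrite (Jac_chain _ _ _ dcp dGcp) cp_id.
have eqK : K - K *m P = P *m (K - K *m P).
  have mulJ (g : E -> E) i j :
      (P *m Jac g y) i j = (P *m 'D_(delta_mx j 0) g y) i 0.
    by rewrite -Jac_col mulmxA -colE [RHS]mxE.
  have subE p (M N : 'M[R]_(n, p)) i j : (M - N) i j = M i j - N i j.
    by rewrite !mxE.
  have JE (g : E -> E) i j : Jac g y i j = 'D_(delta_mx j 0) g y i 0 by rewrite mxE.
  rewrite -KP mulmxBr; apply/matrixP => i j.
  have : 'D_(delta_mx j 0) G y - 'D_(delta_mx j 0) (G \o cp) y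
      = P *m 'D_(delta_mx j 0) G y - P *m 'D_(delta_mx j 0) (G \o cp) y.
    by rewrite {1}DG {1}DGcp opprD addrACA subrr add0r.
  by move/matrixP/(_ i 0); rewrite !subE /K !mulJ !JE.
(* Cyclicity of the trace moves the right-hand [P] of [P *m K *m P] to the front, where idempotence
   absorbs it. *)
apply/eqP; rewrite eq_sym -subr_eq0 /div KP -linearB/= -/K eqK mulmxBr linearB/=.
by rewrite mulmxA (mxtrace_mulC (P *m K)) mulmxA (Jac_cp_idem _ Sy) subrr.
Qed.

End ClosestPoint.

(** * The divergence identity on the surface *)

Lemma near_eq_div {R : realType} {n} (f g : 'cV[R]_n -> 'cV[R]_n) y :
  (\forall x \near y, f x = g x) -> div f y = div g y.
Proof.
move=> fg; congr (\tr _); apply/matrixP => i j; rewrite !mxE.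
by rewrite (near_eq_derive _ fg).
Qed.

Theorem theorem4p3 (R : realType) (n k : nat) (S B : set 'cV[R]_n)
    (A : 'cV[R]_n -> 'M[R]_n) (cp : 'cV[R]_n -> 'cV[R]_n) (u : 'cV[R]_n -> R)
    (le_kn : (k <= n)%N)
    (S_C3 : submanifold 3 k S)
    (S_orientable : orientable k S)
    (B_band : tubular_neighborhood S B)
    (A_C1 : Cr_on 1 S A)
    (A_tangent : forall y, S y -> forall xi, tangent S y xi ->
       tangent S y (A y *m xi))
    (cp_closest : closest_point S B cp)
    (cp_C2 : Cr 2 B cp)
    (cp_tangent : forall x, B x -> forall xi, tangent S (cp x) xi ->
       tangent S (cp x) ((Jac cp x)^T *m xi))
    (u_C2 : Cr_on 2 S u) :
  forall y, S y ->
    sdiv S (fun z => A z *m sgrad S u z) y =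
    div (fun x => A (cp x) *m grad (u \o cp) x) y.
Proof.
move=> y Sy; have [oB SB _] := B_band.
have [cp_in cp_C1 cp_id _] := cp_closest.
have u_C1 z : S z -> exists g, Cr_extension 1 S u z g.
  move=> /u_C2[g [U [oU Uz Cg gu]]]; exists g, U; split => //.
  exact: Cr2_Cr1.
have [uE [U [oU Uy CuE uEu]]] := u_C2 y Sy.
have [AE [U' [oU' Uy' CAE AEA]]] := A_C1 y Sy.
(* On [O] the point [cp x] lies where both local extensions [uE] and [AE] are valid. *)
pose O := B `&` cp @^-1` (U `&` U').
have oO : open O by apply: (open_cp_preimage S B cp) => //; exact: openI.
have Oy : O y by split; [exact: SB|rewrite /= cp_id].
have nO : \forall x \near y, O x by exact: open_nbhs_nbhs.
have OB : O `<=` B by move=> x [].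
have COcp : Cr 1 O cp by exact: Cr_sub OB cp_C1.
have dcp x : O x -> differentiable cp x by move=> /OB; exact: Cr1_diff.
(* Off [S] nothing is known about [u] and [A]; the extensions rewrite the field through maps whose
   smoothness is known. One derivative of [uE] and one of [cp] are spent, so C^2 data give a C^1
   field. *)
pose F x := (Jac cp x)^T *m grad uE (cp x).
pose G x := AE (cp x) *m F x.
have gradF x : O x -> grad (u \o cp) x = F x.
  move=> Ox; have [_ [Ux _]] := Ox.
  rewrite -[F x]grad_chain//; [|exact: dcp|by case: CuE => + _; exact].
  apply/matrixP => i j; rewrite !mxE; apply: near_eq_derive.
  near=> z; have [Bz [Uz _]] : O z by near: z; exact: open_nbhs_nbhs.
  by rewrite /= uEu//; exact: cp_in.
have CG : Cr 1 O G.
  have Ccomp (W : normedModType R) (g : _ -> W) : Cr 1 (U `&` U') g -> Cr 1 O (g \o cp).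
    by move=> Cg; apply: Cr1_comp Cg => // x [].
  have CA : Cr 1 O (AE \o cp) by apply: Ccomp; apply: Cr_sub CAE => x [].
  have CJ : Cr 1 O (fun x => (Jac cp x)^T).
    apply/(Cr1_mxP _ _ oO) => i j; under [X in Cr _ _ X]funext do rewrite !mxE.
    have /(Cr1_mxP _ _ oB)/(_ j 0) := Cr_derive _ _ _ (delta_mx i 0) cp_C2.
    exact: Cr_sub.
  have Cgrad : Cr 1 O (fun x => grad uE (cp x)).
    apply/(Cr1_mxP _ _ oO) => i j; under [X in Cr _ _ X]funext do rewrite mxE.
    apply: (Ccomp _ ('D_(delta_mx i 0) uE)).
    by apply: Cr_sub (Cr_derive _ _ _ _ CuE) => x [].
  exact: Cr1_mulmx _ _ _ oO CA (Cr1_mulmx _ _ _ oO CJ Cgrad).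
have GE x : O x -> A (cp x) *m grad (u \o cp) x = G x.
  by move=> Ox; have [Bx [_ Ux]] := Ox; rewrite gradF// /G AEA//; exact: cp_in.
have GS x : S x -> O x -> G x = A x *m sgrad S u x.
  move=> Sx Ox; rewrite -GE// cp_id// (sgrad_cp S B cp)//.
  exact: u_C1.
(* By [Jac_cp_absorb], transposed, [F x] is [(Jac cp x)^T] applied to
   [(Jac cp (cp x))^T *m grad uE (cp x)]. The inner vector is tangent at [cp x] because
   [Jac cp (cp x)] is symmetric with tangent range; [cp_tangent] and then [A_tangent] preserve
   tangency. *)
have Gtan : \forall x \near y, Jac cp (cp x) *m G x = G x.
  apply: filterS nO => x Ox; have Bx := OB _ Ox; have Scx := cp_in _ Bx.
  apply: (Jac_cp_tangent S B cp) => //.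
  rewrite -GE//; apply: A_tangent => //.
  rewrite gradF// /F -(Jac_cp_absorb S B cp)// trmx_mul -mulmxA.
  apply: cp_tangent => //; rewrite (trmx_Jac_cp S B cp)//.
  exact: (tangent_Jac_cp S B cp).
have dG : differentiable G y := Cr1_diff _ _ _ CG Oy.
have extG : exists h, Cr_extension 1 S (fun z => A z *m sgrad S u z) y h.
  by exists G, O.
apply: etrans (sdiv_cp S B cp oB SB cp_closest _ _ Sy extG) _.
transitivity (div (G \o cp) y); last first.
  apply: etrans (div_cp_tangential S B cp oB SB cp_closest cp_C2 _ _ Sy dG Gtan) _.
  by apply: near_eq_div; apply: filterS nO => x /GE.
(* The field [G] agrees with the surface field at points of [S] in [O], and near [y] the point
   [cp x] is one of these. *)
apply: near_eq_div; near=> x => /=; rewrite GS//.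
- by apply: cp_in; apply: OB; near: x.
- by near: x; exact: (near_cp S B cp).
Unshelve. all: by end_near. Qed.
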